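(* Let $R$ be a commutative unital ring, let $A$ and $B$ be unital associative $R$-algebras and let $M$ be a nonzero $(A,B)$-bimodule that is faithful as a left $A$-module and as a right $B$-module. If $d$ is a centralizing derivation of the triangular algebra $\mathcal{T}=\mathrm{Trian}(A,M,B)$, then $d=0$.
   Context: The triangular algebra $\mathrm{Trian}(A,M,B)$ is the set of all matrices $\begin{pmatrix} a & m\\ & b\end{pmatrix}$ with $a\in A$, $m\in M$, $b\in B$, which is a unital associative $R$-algebra under the usual matrix operations. Derivations are $R$-linear. A linear map $\Theta:\mathcal{A}\to\mathcal{A}$ of an algebra $\mathcal{A}$ is centralizing if $x\Theta(x)-\Theta(x)x$ lies in the center of $\mathcal{A}$ for all $x\in\mathcal{A}$. *)

(* Defs.v *)
From HB Require Import structures.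
From mathcomp Require Import all_boot all_order all_algebra.

Set Implicit Arguments.
Unset Strict Implicit.
Unset Printing Implicit Defensive.

Import GRing.Theory.
Local Open Scope ring_scope.

(* The axioms [lactZl], [lactZr], [ractZl], [ractZr] say that [R] acts on [M]
   in the same way through [A], through [B] and directly; this is what makes
   the triangular matrices an [R]-algebra. *)
HB.mixin Record Lmodule_isBimodule (R : comPzRingType) (A B : algType R) M
    of GRing.Lmodule R M := {
  lact : A -> M -> M;
  ract : M -> B -> M;
  lactA : forall a a' m, lact (a * a') m = lact a (lact a' m);
  lact1 : forall m, lact 1 m = m;
  lactDl : forall a a' m, lact (a + a') m = lact a m + lact a' m;
  lactDr : forall a m m', lact a (m + m') = lact a m + lact a m';
  lactZl : forall r a m, lact (r *: a) m = r *: lact a m;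
  lactZr : forall r a m, lact a (r *: m) = r *: lact a m;
  ractA : forall m b b', ract m (b * b') = ract (ract m b) b';
  ract1 : forall m, ract m 1 = m;
  ractDl : forall m m' b, ract (m + m') b = ract m b + ract m' b;
  ractDr : forall m b b', ract m (b + b') = ract m b + ract m b';
  ractZl : forall r m b, ract (r *: m) b = r *: ract m b;
  ractZr : forall r m b, ract m (r *: b) = r *: ract m b;
  lractA : forall a m b, ract (lact a m) b = lact a (ract m b)
}.

#[short(type="bimodType")]
HB.structure Definition Bimodule (R : comPzRingType) (A B : algType R) :=
  {M of Lmodule_isBimodule R A B M & GRing.Lmodule R M}.

Definition left_faithful (R : comPzRingType) (A B : algType R)
    (M : bimodType A B) : Prop :=
  forall a : A, (forall m : M, lact a m = 0) -> a = 0.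

Definition right_faithful (R : comPzRingType) (A B : algType R)
    (M : bimodType A B) : Prop :=
  forall b : B, (forall m : M, ract m b = 0) -> b = 0.

(* [Trian a m b] is the upper triangular matrix with diagonal entries [a], [b]
   and off-diagonal entry [m]. *)
Record trian (R : comPzRingType) (A B : algType R) (M : bimodType A B) :=
  Trian { tri11 : A; tri12 : M; tri22 : B }.

Section TrianAlgebra.
Variables (R : comPzRingType) (A B : algType R) (M : bimodType A B).
Local Notation T := (trian M).
Implicit Types x y z : T.

Definition trian_prod x := (tri11 x, tri12 x, tri22 x).
Definition prod_trian (p : A * M * B) : T := Trian p.1.1 p.1.2 p.2.

Lemma trian_prodK : cancel trian_prod prod_trian.
Proof. by case. Qed.

HB.instance Definition _ := Choice.copy T (can_type trian_prodK).

Definition trian_zero : T := Trian 0 0 0.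
Definition trian_opp x : T := Trian (- tri11 x) (- tri12 x) (- tri22 x).
Definition trian_add x y : T :=
  Trian (tri11 x + tri11 y) (tri12 x + tri12 y) (tri22 x + tri22 y).
Definition trian_one : T := Trian 1 0 1.
Definition trian_mul x y : T :=
  Trian (tri11 x * tri11 y)
        (lact (tri11 x) (tri12 y) + ract (tri12 x) (tri22 y))
        (tri22 x * tri22 y).
Definition trian_scale (r : R) x : T :=
  Trian (r *: tri11 x) (r *: tri12 x) (r *: tri22 x).

Fact trian_addA : associative trian_add.
Proof. by move=> x y z; rewrite /trian_add /= !addrA. Qed.
Fact trian_addC : commutative trian_add.
Proof. by move=> x y; congr Trian; apply: addrC. Qed.
Fact trian_add0 : left_id trian_zero trian_add.
Proof. by case=> a m b; rewrite /trian_add /= !add0r. Qed.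
Fact trian_addN : left_inverse trian_zero trian_opp trian_add.
Proof. by move=> x; rewrite /trian_add /= !addNr. Qed.

HB.instance Definition _ :=
  GRing.isZmodule.Build T trian_addA trian_addC trian_add0 trian_addN.

Fact lact0 (a : A) : lact a (0 : M) = 0.
Proof. by apply: (addrI (lact a (0 : M))); rewrite -lactDr !addr0. Qed.
Fact ract0 (b : B) : ract (0 : M) b = 0.
Proof. by apply: (addrI (ract (0 : M) b)); rewrite -ractDl !addr0. Qed.

Fact trian_mulA : associative trian_mul.
Proof.
move=> x y z; congr Trian; rewrite /= ?mulrA //.
by rewrite lactDr ractDl lactA ractA lractA addrA.
Qed.
Fact trian_mul1l : left_id trian_one trian_mul.
Proof. by case=> a m b; rewrite /trian_mul /= !mul1r lact1 ract0 addr0. Qed.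
Fact trian_mul1r : right_id trian_one trian_mul.
Proof. by case=> a m b; rewrite /trian_mul /= !mulr1 ract1 lact0 add0r. Qed.
Fact trian_mulDl : left_distributive trian_mul +%R.
Proof.
by move=> x y z; congr Trian; rewrite /= ?mulrDl // lactDl ractDl addrACA.
Qed.
Fact trian_mulDr : right_distributive trian_mul +%R.
Proof.
by move=> x y z; congr Trian; rewrite /= ?mulrDr // lactDr ractDr addrACA.
Qed.
Fact trian_1neq0 : trian_one != 0.
Proof. by apply/eqP=> -[/eqP]; rewrite oner_eq0. Qed.

HB.instance Definition _ := GRing.Zmodule_isNzRing.Build T
  trian_mulA trian_mul1l trian_mul1r trian_mulDl trian_mulDr trian_1neq0.

Fact trian_scaleA r s x :
  trian_scale r (trian_scale s x) = trian_scale (r * s) x.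
Proof. by congr Trian; rewrite /= scalerA. Qed.
Fact trian_scale1 : left_id 1 trian_scale.
Proof. by case=> a m b; rewrite /trian_scale /= !scale1r. Qed.
Fact trian_scaleDr : right_distributive trian_scale +%R.
Proof. by move=> r x y; congr Trian; rewrite /= scalerDr. Qed.
Fact trian_scaleDl x : {morph trian_scale^~ x : r s / r + s}.
Proof. by move=> r s; congr Trian; rewrite /= scalerDl. Qed.

HB.instance Definition _ := GRing.Zmodule_isLmodule.Build R T
  trian_scaleA trian_scale1 trian_scaleDr trian_scaleDl.

Fact trian_scaleAl (r : R) x y : r *: (x * y) = (r *: x) * y.
Proof.
by congr Trian; rewrite /= ?scalerAl // scalerDr lactZl ractZl.
Qed.

HB.instance Definition _ := GRing.Lmodule_isLalgebra.Build R T trian_scaleAl.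

Fact trian_scaleAr (r : R) x y : r *: (x * y) = x * (r *: y).
Proof.
by congr Trian; rewrite /= ?scalerAr // scalerDr lactZr ractZr.
Qed.

HB.instance Definition _ := GRing.Lalgebra_isAlgebra.Build R T trian_scaleAr.

End TrianAlgebra.

Definition central (S : pzRingType) (z : S) : Prop :=
  forall y, GRing.comm z y.

Definition centralizing (S : pzRingType) (f : S -> S) : Prop :=
  forall x, central (x * f x - f x * x).

Definition derivation (S : pzRingType) (d : S -> S) : Prop :=
  forall x y, d (x * y) = d x * y + x * d y.

(* Main.v *)
Require Import Defs.
From HB Require Import structures.
From mathcomp Require Import all_boot all_order all_algebra.

Import GRing.Theory.
Local Open Scope ring_scope.

(* Write e for the matrix unit diag(1, 0). A central element has no M-entry,
   since it commutes with e. As e is idempotent, d(e) lies in M, so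
   [e, d(e)] = d(e); this is central, hence zero. For m in M it follows that
   d(m) = d(e m (1 - e)) lies in M, and [e + m, d(e + m)] = d(m) is central,
   so d kills M. Then 0 = d(x m) = d(x) m and 0 = d(m x) = m d(x), and
   faithfulness kills the diagonal of d(x); its M-entry e d(x) (1 - e) is
   d(e x (1 - e)), which is zero because e x (1 - e) is in M. *)

Section Triangular.
Set Implicit Arguments.
Unset Strict Implicit.
Variables (R : comPzRingType) (A B : algType R) (M : bimodType A B).
Implicit Types (m : M) (x z : trian M).

Definition tri_e : trian M := Trian 1 0 0.
Definition tri_m m : trian M := Trian 0 m 0.

Lemma lact0l m : lact (0 : A) m = 0.
Proof. by apply: (addrI (lact (0 : A) m)); rewrite -lactDl !addr0. Qed.

Lemma ract0r m : ract m (0 : B) = 0.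
Proof. by apply: (addrI (ract m (0 : B))); rewrite -ractDr !addr0. Qed.

Lemma trian_addE x z :
  x + z = Trian (tri11 x + tri11 z) (tri12 x + tri12 z) (tri22 x + tri22 z).
Proof. by []. Qed.

Lemma trian_oppE x : - x = Trian (- tri11 x) (- tri12 x) (- tri22 x).
Proof. by []. Qed.

Lemma trian_mulE x z :
  x * z = Trian (tri11 x * tri11 z)
    (lact (tri11 x) (tri12 z) + ract (tri12 x) (tri22 z)) (tri22 x * tri22 z).
Proof. by []. Qed.

Definition tri_simp := (lact0l, ract0r, @lact0 R A B M, @ract0 R A B M,
  @lact1 R A B M, @ract1 R A B M, mul0r, mulr0, mul1r, mulr1, add0r, addr0,
  subr0, sub0r, oppr0).

Lemma tri_e_idem : tri_e * tri_e = tri_e.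
Proof. by rewrite trian_mulE /= !tri_simp. Qed.

Lemma tri_e_mul_m m : tri_e * tri_m m = tri_m m.
Proof. by rewrite trian_mulE /= !tri_simp. Qed.

Lemma tri_m_mul_e m : tri_m m * tri_e = 0.
Proof. by rewrite trian_mulE /= !tri_simp. Qed.

Lemma tri_mul_m x m : x * tri_m m = tri_m (lact (tri11 x) m).
Proof. by rewrite trian_mulE /= !tri_simp. Qed.

Lemma tri_m_mul x m : tri_m m * x = tri_m (ract m (tri22 x)).
Proof. by rewrite trian_mulE /= !tri_simp. Qed.

(** Cutting out the M-entry by multiplications lets the Leibniz rule act on it. *)
Lemma tri_peirce12 x : tri_e * x * (1 - tri_e) = tri_m (tri12 x).
Proof.
have -> : 1 - tri_e = Trian 0 0 1.
  by rewrite trian_addE trian_oppE /= subrr !tri_simp.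
by rewrite !trian_mulE /= !tri_simp.
Qed.

Lemma central_tri12 z : central z -> tri12 z = 0.
Proof. by move=> /(_ tri_e) []; rewrite !tri_simp. Qed.

Lemma central_tri_m m : central (tri_m m) -> m = 0.
Proof. exact: central_tri12. Qed.

Variable d : {linear trian M -> trian M}.
Hypotheses (dM : derivation d) (d_centr : centralizing d).

Lemma derivation1 : d 1 = 0.
Proof. by apply: (addrI (d 1)); rewrite -{3}(mul1r 1) dM mulr1 mul1r addr0. Qed.

Lemma centralizing_derivation_e : d tri_e = 0.
Proof.
have [m de_m] : exists m, d tri_e = tri_m m.
  exists (tri12 (d tri_e)); have := dM tri_e tri_e; rewrite tri_e_idem.
  case: (d tri_e) => a m b; rewrite !trian_mulE trian_addE /= !tri_simp.
  (* The Leibniz rule at the idempotent gives [a = a + a] in the first entry and [b = 0] in the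
     last; the middle entry gives [m = m]. *)
  by case=> /(congr1 (fun t => t - a)); rewrite subrr addrK => <- ->.
have := d_centr tri_e.
by rewrite de_m tri_e_mul_m tri_m_mul_e subr0 => /central_tri_m ->.
Qed.

(** Since [d] kills [1] and [tri_e], it commutes with the projection sending [x] to
    [tri_e * x * (1 - tri_e)]. *)
Lemma centralizing_derivation_peirce x :
  d (tri_m (tri12 x)) = tri_m (tri12 (d x)).
Proof.
by rewrite -!tri_peirce12 !dM raddfB /= derivation1 centralizing_derivation_e
  subrr mul0r mulr0 add0r addr0.
Qed.

Lemma centralizing_derivation_m m : d (tri_m m) = 0.
Proof.
have dm := centralizing_derivation_peirce (tri_m m); rewrite /= in dm.
rewrite dm; set m' := tri12 _ in dm *.
(* Products of two elements of M vanish, so this commutator reduces to [tri_m m']. *)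
have := d_centr (tri_e + tri_m m).
rewrite raddfD /= centralizing_derivation_e add0r dm mulrDl mulrDr.
rewrite tri_e_mul_m tri_m_mul_e tri_mul_m tri_m_mul /= !tri_simp.
by move/central_tri_m ->.
Qed.

End Triangular.

Theorem corollary5p2 (R : comPzRingType) (A B : algType R)
    (M : bimodType A B)
    (M_neq0 : exists m : M, m <> 0)
    (M_lfaithful : left_faithful M)
    (M_rfaithful : right_faithful M)
    (d : {linear trian M -> trian M})
    (d_derivation : derivation d)
    (d_centralizing : centralizing d) :
  forall x : trian M, d x = 0.
Proof.
move=> x.
have dm := centralizing_derivation_m d_derivation d_centralizing.
have dx11 : tri11 (d x) = 0.
  (* Both [x * tri_m m] and [tri_m m] lie in M, so the Leibniz rule leaves [d x * tri_m m = 0],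
     whose M-entry is [lact (tri11 (d x)) m]. *)
  apply: M_lfaithful => m; have := d_derivation x (tri_m m).
  by rewrite [x * _]tri_mul_m !dm mulr0 addr0 tri_mul_m; case.
have dx22 : tri22 (d x) = 0.
  apply: M_rfaithful => m; have := d_derivation (tri_m m) x.
  by rewrite [_ * x]tri_m_mul !dm mul0r add0r tri_m_mul; case.
have := centralizing_derivation_peirce d_derivation d_centralizing x.
by rewrite dm; case: (d x) dx11 dx22 => a m b /= -> -> [<-].
Qed.
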